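(* For completely reducible trigonal curves $C$ of maximal degree $1$, the only combinatorial type of dessins d'enfants $\Gamma_C$ is $[2,2,2]$ (that is, the set of combinatorial types occurring is exactly $\{[2,2,2]\}$).
   Context: A completely reducible trigonal curve (CRTC) $C$ is a curve given by $(y-y_1)(y-y_2)(y-y_3)=0$ with $y_1,y_2,y_3\in\mathbb{C}[x]$; its maximal degree is $\max\{\deg y_1,\deg y_2,\deg y_3\}=n\ge 1$. All curves are assumed to have no triple intersections: there is no $x_0\in\mathbb{C}$ with $y_1(x_0)=y_2(x_0)=y_3(x_0)$, and (the same condition over $x=\infty$) the coefficients of $x^n$ in $y_1,y_2,y_3$ are not all equal. Put $\lambda=\frac{y_1-y_3}{y_2-y_3}:P^1\to P^1$ and $j_C=\frac{4(\lambda^2-\lambda+1)^3}{27\lambda^2(\lambda-1)^2}:P^1\to P^1$ (the $j$-invariant of $C$), where $P^1=\mathbb{C}\cup\{\infty\}$. The dessin d'enfant of $C$ is the embedded graph $\Gamma_C=j_C^{-1}([0,1])\subset P^1$; its $\bullet$-vertices are the points of $j_C^{-1}(0)$ and its $\circ$-vertices are the points of $j_C^{-1}(1)$. Ramification points of $j_C$ with image in $(0,1)$ are called monochrome vertices; they are not regarded as subdividing edges. The regions of $\Gamma_C$ are the connected components of $P^1\setminus\Gamma_C$. A region is an $m$-gon, where $m$ is its number of boundary edges, counted with $\circ$-vertices disregarded as subdivision points (so $m$ is half the number of passages between a $\bullet$-vertex and a $\circ$-vertex made when traversing the whole boundary of the region once). The combinatorial type of $\Gamma_C$ is the list of these numbers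 $m$ over all regions, written in non-increasing order. *)

(* Defs.v *)
From HB Require Import structures.
From mathcomp Require Import all_boot all_order all_algebra.
From mathcomp Require Import finmap.
From mathcomp Require Import all_classical all_reals.
From mathcomp Require Import topology normedtype.
From mathcomp Require Export complex.
Set Implicit Arguments.
Unset Strict Implicit.
Unset Printing Implicit Defensive.
Import Order.TTheory GRing.Theory Num.Theory.
Import numFieldNormedType.Exports.
Local Open Scope classical_set_scope.
Local Open Scope ring_scope.
Local Open Scope complex_scope.

(* The one-point compactification of C with the topology given by the modulus
   (carried by [R[i]^o]); [None] is the point at infinity. *)
Definition P1 (R : realType) := one_point_compactification R[i]^o.
HB.instance Definition _ (R : realType) := Topological.on (P1 R).

(* The point of P1 with homogeneous coordinates [a : b]; only meaningful when
   (a, b) <> (0, 0). *)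
Definition P1_of (R : realType) (a b : R[i]) : P1 R :=
  if b == 0 then None else Some (a / b).

Definition max_degree (R : realType) (y1 y2 y3 : {poly R[i]}) : nat :=
  maxn (size y1).-1 (maxn (size y2).-1 (size y3).-1).

(* Completely reducible trigonal curves (y - y1)(y - y2)(y - y3) = 0 without
   triple intersections, over x in C ([no_triple]) and over x = oo
   ([no_triple_infty]). *)
Record crtc (R : realType) := Crtc {
  branch1 : {poly R[i]};
  branch2 : {poly R[i]};
  branch3 : {poly R[i]};
  maxdeg := max_degree branch1 branch2 branch3;
  maxdeg_gt0 : (0 < maxdeg)%N;
  no_triple : forall x : R[i],
    ~ (branch1.[x] = branch2.[x] /\ branch2.[x] = branch3.[x]);
  no_triple_infty :
    ~ (branch1`_maxdeg = branch2`_maxdeg /\ branch2`_maxdeg = branch3`_maxdeg)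
}.

Section Dessin.
Variables (R : realType) (C : crtc R).

(* The values of y1 - y3 and y2 - y3 at x (at oo: their coefficients of x^n,
   n being the maximal degree) never vanish simultaneously, by [no_triple] and
   [no_triple_infty]; so the rational function (y1 - y3) / (y2 - y3), extended
   to P1, is computed pointwise by [P1_of]. *)
Definition lambda (x : P1 R) : P1 R :=
  match x with
  | Some z => P1_of ((branch1 C).[z] - (branch3 C).[z])
                    ((branch2 C).[z] - (branch3 C).[z])
  | None => P1_of ((branch1 C)`_(maxdeg C) - (branch3 C)`_(maxdeg C))
                  ((branch2 C)`_(maxdeg C) - (branch3 C)`_(maxdeg C))
  end.

(* The numerator has degree 6 and the denominator degree 4, whence the value at
   oo; the two have no common zero. *)
Definition j_of_lambda (l : P1 R) : P1 R :=
  match l with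
  | Some z => P1_of (4%:R * (z ^+ 2 - z + 1) ^+ 3)
                    (27%:R * z ^+ 2 * (z - 1) ^+ 2)
  | None => None
  end.

Definition j_invariant (x : P1 R) : P1 R := j_of_lambda (lambda x).

Definition dessin : set (P1 R) :=
  j_invariant @^-1` [set Some s%:C | s in `[0, 1]%classic].

Definition regions : set (set (P1 R)) :=
  [set connected_component (~` dessin) x | x in ~` dessin].

(* A passage [e] between a bullet-vertex and a circ-vertex: along an edge j
   varies monotonically between 0 and 1, so the edge is parametrized by the
   value s of j.  Monochrome vertices may be crossed, and are not recorded. *)
Definition passage_param (g : R -> P1 R) : Prop :=
  {within `[0, 1], continuous g} /\
  forall s : R, s \in `[0, 1]%R -> j_invariant (g s) = Some s%:C.

(* As j preserves the orientation, the left (resp. right) side of a passage,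
   seen from its bullet-vertex to its circ-vertex, is where Im j > 0
   (resp. Im j < 0). *)
Definition on_side (left : bool) (x : P1 R) : Prop :=
  exists2 z : R[i], j_invariant x = Some z &
    if left then 0 < complex.Im z else complex.Im z < 0.

(* The region [U] lies along the given side of the passage [g] if the whole
   (open) passage can be pushed off into [U] on that side.  Pushing the passage
   as a whole forces it to turn inside [U] at the monochrome vertices, as the
   boundary of [U] does. *)
Definition runs_along (U : set (P1 R)) (g : R -> P1 R) (left : bool) : Prop :=
  exists H : R * R -> P1 R,
    [/\ {within `[0, 1] `*` `[0, 1], continuous H},
        forall s : R, s \in `[0, 1]%R -> H (s, 0) = g s &
        forall s t : R, s \in `]0, 1[%R -> t \in `]0, 1]%R ->
          U (H (s, t)) /\ on_side left (H (s, t))].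

(* The passages made when traversing the whole boundary of [U] once, [U] being
   kept on the left: (e, true) stands for the passage through [e] from its
   bullet-vertex to its circ-vertex, (e, false) for the passage through [e] in
   the other direction.  An edge with [U] on both sides is thus passed twice. *)
Definition boundary_passages (U : set (P1 R)) : set (set (P1 R) * bool) :=
  [set p | exists g : R -> P1 R,
    [/\ passage_param g, p.1 = g @` `[0, 1]%classic & runs_along U g p.2]].

(* [U] is an m-gon for m = [gon U]. *)
Definition gon (U : set (P1 R)) : nat :=
  (#|` fset_set (boundary_passages U)|)./2.

Definition combinatorial_type : seq nat :=
  sort geq [seq gon U | U <- fset_set regions].

End Dessin.

(* Main.v *)
Require Import Defs.
From mathcomp Require Import all_boot all_order all_algebra.
From mathcomp Require Import finmap.
From mathcomp Require Import all_classical all_reals.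
From mathcomp Require Import topology normedtype realfun ring lra.
Local Open Scope classical_set_scope.
Set Implicit Arguments.
Unset Strict Implicit.
Unset Printing Implicit Defensive.
Import Order.TTheory GRing.Theory Num.Theory.
Import numFieldNormedType.Exports.

(** For a curve of maximal degree one, lambda is the quotient of two linear
    forms; the absence of triple intersections says that these have no common
    zero, so that lambda is a Moebius transformation, hence a homeomorphism of
    the sphere ([homeo_lambda]).  The dessin is therefore the preimage of one
    fixed graph in the lambda-sphere, the set of l where j(l) is in [0, 1]: a
    theta graph made of the segment of the line Re l = 1/2 and the arcs of the
    circles |l| = 1 and |l - 1| = 1 which join exp(i pi / 3) to
    exp(- i pi / 3), with middle points 1/2, -1 and 2 over j = 1.

    The anharmonic group, generated by l |-> 1 - l and l |-> 1 / l, preserves j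
    and permutes the three faces of the graph, which contain 0, 1 and oo.  So
    everything reduces to one face, [region0], the part of the unit disk where
    Re l < 1/2.  A factorization of Im j, [Im_j], and the formula for j on the
    line Re l = 1/2, [j_edge], show that the complement of the graph is the
    disjoint union of the three faces ([outside_regions],
    [region0_not_dessin]).  The faces are open and connected, so they are the
    components ([regionsE]).

    For the number of passages around [region0]: on each half of the edge on
    Re l = 1/2, j is strictly monotonic, so j parametrizes it; shrinking it
    towards 0 pushes it off into [region0] ([runs_along_edge]).  The symmetry
    l |-> l / (l - 1) preserves [region0] and provides the two passages along
    the arc.  Conversely, a passage pushed off into [region0] on a given side
    sweeps a connected set on which Im j has constant sign, so that Im l does
    not vanish there, and this determines the half-edge which it approaches
    ([push_half_plane], [push_edge]).  Hence four passages around each region: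
    each region is a 2-gon. *)

(** * Continuity of complex-valued maps *)

Section ComplexTopology.
Variable R : realType.
Local Open Scope ring_scope.
Local Open Scope complex_scope.
Implicit Types z : R[i].

Lemma normc_ge_Im z : `|complex.Im z|%:C <= `|z|.
Proof.
have := normc_ge_Re (z * 'i)%C.
by rewrite ReiNIm normrN normrM [X in _ * X]normc_def /= expr0n expr1n add0r sqrtr1 mulr1.
Qed.

Lemma continuous_real_complex : continuous (fun x : R => x%:C : R[i]^o).
Proof.
move=> x; apply/cvgrPdist_lt => e e0.
have [e' e'0 ->] : exists2 e', 0 < e' & e = e'%:C.
  by move: e0; rewrite ltcE /= => /andP[/eqP i0 r0]; exists (complex.Re e) => //; case: e i0 r0 => a b /= -> .
near=> y; rewrite -rmorphB /= normc_def /= expr0n addr0 sqrtr_sqr ltcR.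
near: y; exact: cvgr_dist_lt.
Unshelve. all: by end_near. Qed.

Lemma continuous_Re : continuous (fun z : R[i]^o => complex.Re z : R).
Proof.
move=> z; apply/(@cvgrPdist_lt _ R^o _ (nbhs (z : R[i]^o)) _) => e e0.
have H : \forall w \near (z : R[i]^o), `|(z : R[i]^o) - w| < e%:C.
  by apply: (@cvgr_dist_lt _ (R[i]^o) _ (nbhs (z : R[i]^o)) _ id); rewrite ?ltcR //; exact: cvg_id.
apply: filterS H => w; rewrite -ltcR -raddfB; exact/le_lt_trans/normc_ge_Re.
Qed.

Lemma continuous_Im : continuous (fun z : R[i]^o => complex.Im z : R).
Proof.
move=> z; apply/(@cvgrPdist_lt _ R^o _ (nbhs (z : R[i]^o)) _) => e e0.
have H : \forall w \near (z : R[i]^o), `|(z : R[i]^o) - w| < e%:C.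
  by apply: (@cvgr_dist_lt _ (R[i]^o) _ (nbhs (z : R[i]^o)) _ id); rewrite ?ltcR //; exact: cvg_id.
apply: filterS H => w; rewrite -ltcR -raddfB; exact/le_lt_trans/normc_ge_Im.
Qed.

(** The topology of the complex numbers comes from the modulus; with
    this lemma, a path given by its two coordinates is treated in the reals. *)
Lemma cvg_complex (T : Type) (F : set_system T) (FF : Filter F) (f g : T -> R) a b :
  f @ F --> a -> g @ F --> b -> (fun x => f x +i* g x : R[i]^o) @ F --> (a +i* b : R[i]^o).
Proof.
move=> fa gb.
have E u v : (u +i* v : R[i]^o) = (u%:C : R[i]^o) + ('i%C : R[i]^o) * (v%:C : R[i]^o).
  by rewrite [LHS]complexE.
rewrite E; under eq_fun do rewrite E.
apply: cvgD; first exact: (cvg_comp _ _ fa (@continuous_real_complex a)).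
apply: cvgMr; exact: (cvg_comp _ _ gb (@continuous_real_complex b)).
Qed.

End ComplexTopology.

(** * Homeomorphisms of the sphere *)

Lemma within_continuous_comp (X Y Z : topologicalType) (A : set X) (g : X -> Y) (f : Y -> Z) :
  {within A, continuous g} -> continuous f -> {within A, continuous f \o g}.
Proof.
move=> /subspace_continuousP cg cf; apply/subspace_continuousP => x Ax.
exact: cvg_comp (cg x Ax) (cf _).
Qed.

Section SphereHomeos.
Variable R : realType.
Local Open Scope ring_scope.
Local Open Scope complex_scope.
Implicit Types (z w : R[i]) (f g : P1 R -> P1 R).

Definition homeo f : Prop :=
  exists g, [/\ continuous f, continuous g, cancel f g & cancel g f].

Lemma homeo_comp f g : homeo f -> homeo g -> homeo (f \o g).
Proof.
move=> [f' [cf cf' fK f'K]] [g' [cg cg' gK g'K]]; exists (g' \o f'); split.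
- by move=> x; apply: continuous_comp; [exact: cg|exact: cf].
- by move=> x; apply: continuous_comp; [exact: cf'|exact: cg'].
- exact: can_comp.
- exact: can_comp.
Qed.

Definition sqmod z : R := complex.Re z ^+ 2 + complex.Im z ^+ 2.

Lemma sqmodE z : (sqmod z)%:C = `|z| ^+ 2.
Proof. exact: add_Re2_Im2. Qed.

Lemma sqmodV z : sqmod z^-1 = (sqmod z)^-1.
Proof. by apply: complexI; rewrite fmorphV /= !sqmodE normfV exprVn. Qed.

Lemma sqmodM z w : sqmod (z * w) = sqmod z * sqmod w.
Proof. by apply: complexI; rewrite rmorphM /= !sqmodE normrM exprMn. Qed.

Lemma sqmod_gt0 z : (0 < sqmod z) = (z != 0).
Proof.
rewrite lt0r addr_ge0 ?sqr_ge0// andbT /sqmod paddr_eq0 ?sqr_ge0// !sqrf_eq0.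
by rewrite eq_complex.
Qed.

Lemma continuous_sqmod : continuous (sqmod : R[i]^o -> R).
Proof.
have sqr (h : R[i]^o -> R) : continuous h -> continuous (fun z : R[i]^o => h z ^+ 2).
  move=> ch z; apply: (@continuous_comp _ R R h (fun x => x ^+ 2)); first exact: ch.
  exact: exprn_continuous.
move=> z; exact: (@cvgD _ _ _ (nbhs (z : R[i]^o)) _ _ _ _ _
  (sqr _ (@continuous_Re R) z) (sqr _ (@continuous_Im R) z)).
Qed.

Definition affine (a b : R[i]) (p : P1 R) : P1 R :=
  if p is Some z then Some (a * z + b) else None.

Lemma continuous_affineC (a b : R[i]) :
  continuous (fun z : R[i]^o => a * z + b : R[i]^o).
Proof.
move=> z; apply: (@cvgD R[i] R[i]^o _ (nbhs (z : R[i]^o)) _ (fun z => a * z) (fun=> b)).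
  apply: (@cvgM R[i] _ (nbhs (z : R[i]^o)) _ (fun=> a) id a z); last exact: cvg_id.
  exact: (@cvg_cst R[i]^o).
exact: (@cvg_cst R[i]^o).
Qed.

Lemma affineK a b : a != 0 -> cancel (affine a b) (affine a^-1 (- (a^-1 * b))).
Proof. by move=> a0 [z|] //=; congr Some; rewrite mulrDr mulKf// addrK. Qed.

Lemma affineVK a b : a != 0 -> cancel (affine a^-1 (- (a^-1 * b))) (affine a b).
Proof. by move=> a0 [z|] //=; congr Some; rewrite mulrDr mulVKf// mulrN mulVKf// subrK. Qed.

(** At infinity, neighbourhoods are complements of compact sets, and the
    preimage of a compact set is its image under the inverse affine map. *)
Lemma continuous_affine a b : a != 0 -> continuous (affine a b).
Proof.
move=> a0 [z|] U.
  by move=> UU; exact: (@continuous_affineC a b z (Some @^-1` U)).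
case=> K [Kc Kcl] KU.
exists ((fun z : R[i]^o => a * z + b : R[i]^o) @^-1` K).
  split; last exact: ((continuous_closedP _).1 (@continuous_affineC a b) _ Kcl).
  rewrite (_ : _ @^-1` _ =
    (fun z : R[i]^o => a^-1 * z + (- (a^-1 * b)) : R[i]^o) @` K).
    apply: continuous_compact => //; apply: continuous_subspaceT.
    exact: continuous_affineC.
  apply/seteqP; split => [z /= Kz|_ [z Kz <-] /=].
    by exists (a * z + b) => //; case: (@affineK a b a0 (Some z)).
  by have /= [->] := @affineVK a b a0 (Some z).
move=> _ [[z /= nK <-]|->]; apply: KU; last by right.
by left; exists (a * z + b).
Qed.

Lemma homeo_affine a b : a != 0 -> homeo (affine a b).
Proof.
move=> a0; exists (affine a^-1 (- (a^-1 * b))); split.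
- exact: continuous_affine.
- by apply: continuous_affine; rewrite invr_eq0.
- exact: affineK.
- exact: affineVK.
Qed.

(** The map z |-> 1 / z, exchanging 0 and the point at infinity. *)
Definition inversion (p : P1 R) : P1 R := if p is Some z then P1_of 1 z else Some 0.

Lemma inversionK : involutive inversion.
Proof.
case=> [z|] /=; rewrite /P1_of ?eqxx//=.
have [->//|z0] := eqVneq z 0.
by rewrite /= /P1_of !div1r invr_eq0 (negbTE z0) invrK.
Qed.

Lemma compact_bounded_sqmod (K : set R[i]^o) : compact K ->
  exists2 M : R, 0 < M & forall z, K z -> sqmod z <= M.
Proof.
move=> Kc.
have /compact_bounded[M [_ HM]] : compact ((sqmod : R[i]^o -> R) @` K : set R^o).
  by apply: continuous_compact => //; apply: continuous_subspaceT; exact: continuous_sqmod.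
exists (Num.max M 0 + 1); first by rewrite ltr_wpDl // le_max lexx orbT.
move=> z Kz; apply: le_trans (ler_norm _) (HM _ _ _ _); last by exists z.
by rewrite ltr_pwDr // le_max lexx.
Qed.

(** Squares rather than disks, since a product of segments is compact. *)
Definition square (M : R) : set R[i]^o :=
  [set z | - M <= complex.Re z <= M /\ - M <= complex.Im z <= M].

Lemma square_compact M : compact (square M).
Proof.
rewrite (_ : square M =
   (fun p : R * R => p.1 +i* p.2 : R[i]^o) @` (`[- M, M] `*` `[- M, M])).
  apply: continuous_compact.
    apply: continuous_subspaceT => p.
    by apply: cvg_complex; [exact: cvg_fst|exact: cvg_snd].
  by apply: compact_setX; exact: segment_compact.
apply/seteqP; split => [[a b] /= [Ha Hb]|_ [[a b] /= [Ha Hb] <-]].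
  by exists (a, b) => //; split; rewrite /= in_itv.
by move: Ha Hb; rewrite !in_itv.
Qed.

Lemma square_closed M : closed (square M).
Proof.
rewrite (_ : square M = (fun z : R[i]^o => complex.Re z : R) @^-1` `[- M, M] `&`
  (fun z : R[i]^o => complex.Im z : R) @^-1` `[- M, M]).
  have clI : closed (`[- M, M] : set R) by exact: interval_closed.
  apply: closedI.
    exact: ((continuous_closedP _).1 (@continuous_Re R) _ clI).
  exact: ((continuous_closedP _).1 (@continuous_Im R) _ clI).
by apply/seteqP; split => z /=; rewrite !in_itv.
Qed.

Lemma not_square M z : 0 <= M -> ~ square M z -> M ^+ 2 < sqmod z.
Proof.
move=> M0; apply: contra_notP => /negP; rewrite -leNgt /sqmod => H.
have h (x y : R) : x ^+ 2 + y ^+ 2 <= M ^+ 2 -> - M <= x <= M.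
  move=> xy; rewrite -ler_norml -(ler_pXn2r (n:=2)) ?nnegrE// real_normK ?num_real//.
  by apply: le_trans xy; rewrite lerDl sqr_ge0.
by split; apply: h; [exact: H|rewrite addrC; exact: H].
Qed.

(** At 0, compact sets are bounded, so 1 / z leaves any of them when z tends
    to 0; at infinity, 1 / z is small outside a large square. *)
Lemma continuous_inversion : continuous inversion.
Proof.
case=> [z|] U.
  have [->|z0] := eqVneq z 0.
    rewrite /= /P1_of eqxx => -[K [Kc _] KU].
    have [M M0 HM] := compact_bounded_sqmod Kc.
    have : \forall w \near (0 : R[i]^o), sqmod w < M^-1.
      apply: (@continuous_sqmod 0 [set x | x < M^-1]); apply: lt_nbhsl.
      by rewrite /sqmod /= expr0n addr0 invr_gt0.
    apply: filterS => w wM /=; apply: KU; rewrite /P1_of.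
    have [_|w0] := eqVneq w 0; [by right|left].
    exists w^-1; last by rewrite div1r.
    by move=> /HM; rewrite leNgt sqmodV -[M]invrK ltf_pV2 ?wM// posrE ?invr_gt0 ?sqmod_gt0.
  rewrite /= /P1_of (negbTE z0) div1r => UU.
  have near1 : \forall w \near (z : R[i]^o), U (Some w^-1).
    exact: (@cvgV _ _ (nbhs (z : R[i]^o)) _ id z z0 (@cvg_id _ _) (Some @^-1` U)).
  have near2 : \forall w \near (z : R[i]^o), 0 < sqmod w.
    by apply: (@continuous_sqmod z [set x | 0 < x]); apply: lt_nbhsr; rewrite sqmod_gt0.
  by apply: filterS2 near1 near2 => w Uw; rewrite sqmod_gt0 /= /P1_of => /negbTE->; rewrite div1r.
move=> UU.
have /nbhs_ballP[e e0 eU] : nbhs (0 : R[i]^o) (Some @^-1` U) by [].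
have [r r0 er] : exists2 r : R, 0 < r & e = r%:C.
  move: e0; rewrite /= ltcE /= => /andP[/eqP i0 ?]; exists (complex.Re e) => //.
  by rewrite [LHS]complexE i0 mulr0 addr0.
exists (square r^-1); first by split; [exact: square_compact|exact: square_closed].
move=> _ [[w /= /not_square sw <-]|->]; last by apply: eU; exact: ballxx.
have {}sw : r ^- 2 < sqmod w by rewrite -exprVn; apply: sw; rewrite invr_ge0 ltW.
have w0 : w != 0 by rewrite -sqmod_gt0 (le_lt_trans _ sw)// invr_ge0 sqr_ge0.
rewrite /= /P1_of (negbTE w0) div1r; apply: eU.
rewrite -ball_normE /= sub0r normrN normc_def er ltcR.
rewrite -[ltRHS]gtr0_norm// -sqrtr_sqr ltr_sqrt ?exprn_gt0//.
rewrite -[ltLHS]/(sqmod w^-1) sqmodV -[ltRHS]invrK ltf_pV2// posrE ?sqmod_gt0//.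
by rewrite invr_gt0 exprn_gt0.
Qed.

Lemma homeo_inversion : homeo inversion.
Proof.
by exists inversion; split; (exact: continuous_inversion || exact: inversionK).
Qed.

End SphereHomeos.

(** * The map lambda of a curve of maximal degree one *)

Section Lambda.
Variable R : realType.
Local Open Scope ring_scope.
Local Open Scope complex_scope.

(** A Moebius transformation is affine when it fixes infinity; otherwise
    division of p z + q by r z + s writes it as an affine map after the
    inversion after z |-> r z + s. *)
Lemma homeo_mobius (f : P1 R -> P1 R) (p q r s : R[i]) : p * s - q * r != 0 ->
  (forall z, f (Some z) = P1_of (p * z + q) (r * z + s)) -> f None = P1_of p r ->
  homeo f.
Proof.
move=> d0 fS fN; have [r0|r0] := eqVneq r 0.
  have [p0 s0] : p != 0 /\ s != 0.
    by apply/andP; rewrite -negb_or -mulf_eq0; move: d0; rewrite r0 mulr0 subr0.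
  rewrite (_ : f = affine (p / s) (q / s)); first by apply: homeo_affine; rewrite mulf_neq0 ?invr_eq0.
  apply/funext => -[z|]; last by rewrite fN r0 /P1_of eqxx.
  by rewrite fS r0 mul0r add0r /P1_of (negbTE s0) /=; congr Some; field.
have a0 : q - p * s / r != 0.
  by apply: contra_neq d0 => h; rewrite -[RHS](mulr0 (- r)) -h; field.
rewrite (_ : f = affine (q - p * s / r) (p / r) \o (@inversion R \o affine r s)).
  by apply: homeo_comp (homeo_affine _ a0) (homeo_comp (homeo_inversion R) (homeo_affine _ r0)).
apply/funext => -[z|] /=; last by rewrite fN /P1_of (negbTE r0) mulr0 add0r.
rewrite fS /P1_of; have [//|n0] := eqVneq (r * z + s) 0.
by congr Some; field; rewrite r0.
Qed.

Lemma horner_size2 (p : {poly R[i]}) z : (size p <= 2)%N -> p.[z] = p`_1 * z + p`_0.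
Proof.
move=> sp; rewrite (horner_coef_wide _ sp) big_ord_recl big_ord1.
by rewrite /= expr0 expr1 mulr1 addrC.
Qed.

(** If the determinant vanished, the two linear forms y1 - y3 and y2 - y3 would
    have a common zero, finite or at infinity: a triple intersection. *)
Lemma homeo_lambda (C : crtc R) : maxdeg C = 1%N -> homeo (lambda C).
Proof.
move=> C1.
have [s1 s2 s3] : [/\ size (branch1 C) <= 2, size (branch2 C) <= 2 & size (branch3 C) <= 2]%N.
  move: C1; rewrite /maxdeg /max_degree => C1.
  have h m : (m.-1 <= 1 -> m <= 2)%N by case: m.
  by split; apply: h; rewrite -C1 !leq_max leqnn ?orbT.
have Ninf := @no_triple_infty _ C; have Nfin := @no_triple _ C.
move: Ninf Nfin; rewrite -/(maxdeg C) C1.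
set y1 := branch1 C; set y2 := branch2 C; set y3 := branch3 C => Ninf Nfin.
have E (a b c d z : R[i]) : a * z + b - (c * z + d) = (a - c) * z + (b - d) by ring.
apply: (@homeo_mobius _ (y1`_1 - y3`_1) (y1`_0 - y3`_0) (y2`_1 - y3`_1) (y2`_0 - y3`_0)); last 2 first.
- by move=> z; rewrite /lambda !horner_size2// !E.
- by rewrite /lambda C1.
set p := y1`_1 - _; set q := y1`_0 - _; set r := y2`_1 - _; set s := y2`_0 - _.
apply/eqP => d0.
have zero x : p * x + q = 0 -> r * x + s = 0 -> False.
  move=> e1 e2; apply: (Nfin x); rewrite !horner_size2//.
  have e13 : y1`_1 * x + y1`_0 = y3`_1 * x + y3`_0.
    by apply/eqP; rewrite -subr_eq0 E e1.
  have e23 : y2`_1 * x + y2`_0 = y3`_1 * x + y3`_0.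
    by apply/eqP; rewrite -subr_eq0 E e2.
  by rewrite e13 e23.
have [p0|p0] := eqVneq p 0; last first.
  apply: (zero (- q / p)); first by field.
  by apply: (mulfI p0); rewrite mulr0 -d0; field.
have [r0|r0] := eqVneq r 0.
  by apply: Ninf; split; apply/eqP; rewrite -subr_eq0 ?(subr0_eq p0) ?(subr0_eq r0) ?subrr.
apply: (zero (- s / r)); last by field.
by rewrite p0 mul0r add0r; apply: (mulIf r0); apply/eqP; rewrite mul0r -oppr_eq0 -d0 p0 mul0r sub0r.
Qed.

Lemma std_maxdeg : max_degree ('X : {poly R[i]}) 1 0 = 1%N.
Proof. by rewrite /max_degree size_polyX size_poly1 size_poly0. Qed.

(** A curve whose lambda is the identity: it shows that the type [2, 2, 2]
    occurs, and carries the computations made in the lambda-sphere. *)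
Definition std_curve : crtc R.
Proof.
apply: (@Crtc R 'X 1 0).
- by rewrite std_maxdeg.
- by move=> x []; rewrite !hornerE => _ /eqP; rewrite oner_eq0.
- by rewrite std_maxdeg coefX coef1 => -[/eqP]; rewrite oner_eq0.
Defined.

Lemma maxdeg_std_curve : maxdeg std_curve = 1%N.
Proof. exact: std_maxdeg. Qed.

Lemma lambda_std_curve : lambda std_curve = id.
Proof.
apply/funext => -[z|]; rewrite /lambda.
  by rewrite /= !hornerE !subr0 /P1_of oner_eq0 divr1.
by rewrite maxdeg_std_curve /= coefX coef1 coef0 !subr0 /P1_of eqxx.
Qed.

Lemma j_invariant_std_curve : j_invariant std_curve = @j_of_lambda R.
Proof. by apply/funext => x; rewrite /j_invariant lambda_std_curve. Qed.

End Lambda.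

(** * The j-invariant and its anharmonic symmetries *)

Section JInvariant.
Variable R : realType.
Local Open Scope ring_scope.
Local Open Scope complex_scope.
Implicit Types (z w : R[i]) (x y s : R).

Lemma P1_of_scale (k a b : R[i]) : k != 0 -> P1_of (k * a) (k * b) = P1_of a b.
Proof.
move=> k0; rewrite /P1_of mulf_eq0 (negbTE k0) /=.
by have [//|b0] := eqVneq b 0; congr Some; field; rewrite ?k0 ?b0.
Qed.

Lemma j_one_sub (p : P1 R) : j_of_lambda (affine (-1) 1 p) = j_of_lambda p.
Proof. by case: p => [z|//] /=; congr P1_of; ring. Qed.

Lemma j_inversion (p : P1 R) : j_of_lambda (inversion p) = j_of_lambda p.
Proof.
case: p => [z|] /=; last by rewrite /P1_of expr0n /= mulr0 mul0r eqxx.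
rewrite {1}/P1_of; have [->|z0] := eqVneq z 0.
  by rewrite /= /P1_of expr0n /= mulr0 mul0r eqxx.
rewrite /= -[RHS](@P1_of_scale (z ^- 6)) ?invr_eq0 ?expf_neq0//.
by congr P1_of; field.
Qed.

Lemma complex_nat (n : nat) : n%:R = n%:R +i* 0 :> R[i].
Proof. by rewrite -[LHS](rmorph_nat (real_complex R)). Qed.

Lemma complexD (a b c d : R) : (a +i* b) + (c +i* d) = (a + c) +i* (b + d).
Proof. by []. Qed.
Lemma complexN (a b : R) : - (a +i* b) = (- a) +i* (- b).
Proof. by []. Qed.
Lemma complexM (a b c d : R) : (a +i* b) * (c +i* d) = (a * c - b * d) +i* (a * d + b * c).
Proof. by []. Qed.
Lemma complex_div (a b c d : R) : (a +i* b) / (c +i* d) =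
  ((a * c + b * d) / (c ^+ 2 + d ^+ 2)) +i* ((b * c - a * d) / (c ^+ 2 + d ^+ 2)).
Proof.
rewrite (_ : (c +i* d)^-1 = (c / (c ^+ 2 + d ^+ 2)) -i* (d / (c ^+ 2 + d ^+ 2)));
  last by rewrite /GRing.inv; unlock.
rewrite complexM.
move: (_^-1) => n; by apply/eqP; rewrite eq_complex /=; apply/andP; split; apply/eqP; ring.
Qed.

(** Both j_num and j_den expand z ^ 2 - z + 1 as u + i v; they share u since
    z (z - 1) = (z ^ 2 - z + 1) - 1. *)
Lemma j_num x y (u := x ^+ 2 - y ^+ 2 - x + 1) (v := y * (2 * x - 1)) :
  4%:R * ((x +i* y) ^+ 2 - (x +i* y) + 1) ^+ 3 =
    (4 * (u ^+ 3 - 3 * u * v ^+ 2)) +i* (4 * (3 * u ^+ 2 * v - v ^+ 3)).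
Proof.
rewrite (_ : (x +i* y) ^+ 2 - (x +i* y) + 1 = u +i* v).
  rewrite complex_nat !exprS expr0 mulr1 !complexM.
  by apply/eqP; rewrite eq_complex /=; apply/andP; split; apply/eqP; ring.
rewrite (_ : 1 = 1 +i* 0) // expr2 complexM complexN !complexD.
by apply/eqP; rewrite eq_complex /= /u /v; apply/andP; split; apply/eqP; ring.
Qed.

Lemma j_den x y (u := x ^+ 2 - y ^+ 2 - x + 1) (v := y * (2 * x - 1)) :
  27%:R * (x +i* y) ^+ 2 * (x +i* y - 1) ^+ 2 =
    (27 * ((u - 1) ^+ 2 - v ^+ 2)) +i* (27 * (2 * (u - 1) * v)).
Proof.
rewrite complex_nat (_ : 1 = 1 +i* 0) // !expr2 complexN !(complexM, complexD).
by apply/eqP; rewrite eq_complex /= /u /v; apply/andP; split; apply/eqP; ring.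
Qed.

Lemma j_finite z : z != 0 -> z != 1 -> exists w, j_of_lambda (Some z) = Some w.
Proof.
move=> z0 z1; rewrite /= /P1_of ifF; first by eexists.
by rewrite !mulf_eq0 pnatr_eq0 (negbTE z0) subr_eq0 (negbTE z1).
Qed.

Lemma j_finite_neq z w : j_of_lambda (Some z) = Some w -> z != 0 /\ z != 1.
Proof.
rewrite /= /P1_of; case: ifP => // /negbT.
by rewrite !mulf_eq0 pnatr_eq0 subr_eq0 !orbb negb_or => /andP[].
Qed.

(** The curves where j is real are the real line, the line Re z = 1/2 and the
    circles |z| = 1 and |z - 1| = 1 (the mirrors of the anharmonic group), so
    Im j is divisible by the product of their equations.  With A = |z| ^ 2 and
    B = |z - 1| ^ 2, the cofactor is A B + A + B up to a positive factor. *)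
Lemma Im_j x y w : j_of_lambda (Some (x +i* y)) = Some w ->
  exists2 k : R, 0 < k & complex.Im w = k *
    (y * (2 * x - 1) * (x ^+ 2 + y ^+ 2 - 1) * (x ^+ 2 + y ^+ 2 - 2 * x)).
Proof.
move=> jw; have [z0 z1] := j_finite_neq jw.
move: jw; rewrite /= j_num j_den /P1_of; case: ifP => // /negbT.
set u := _ - x + 1; set v := y * _; rewrite eq_complex /= negb_and => D0 [<-].
rewrite complex_div /=.
set a := 4 * _; set b := 4 * _ ; set c := 27 * _; set d := 27 * _.
have cd0 : 0 < c ^+ 2 + d ^+ 2.
  by case/orP: D0 => h; [apply: ltr_pwDl|apply: ltr_wpDl];
    rewrite ?sqr_ge0// exprn_even_gt0.
pose A := x ^+ 2 + y ^+ 2; pose B := A - 2 * x + 1.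
have A0 : 0 < A.
  have := sqmod_gt0 (x +i* y); rewrite z0 => h; exact: h.
have B0 : 0 <= B by rewrite (_ : B = (x - 1) ^+ 2 + y ^+ 2) ?addr_ge0 ?sqr_ge0// /B /A; ring.
exists (108 * (A * B + A + B) / (c ^+ 2 + d ^+ 2)).
  by rewrite divr_gt0// mulr_gt0// ltr_wpDr// ltr_wpDl// mulr_ge0// ltW.
rewrite [RHS]mulrAC; congr (_ / _).
by rewrite /a /b /c /d /B /A /u /v; ring.
Qed.

(** The value of j at 1/2 + i y. *)
Definition edge_j y : R := 4 * (3 / 4 - y ^+ 2) ^+ 3 / (27 * (1 / 4 + y ^+ 2) ^+ 2).

Lemma j_edge y : j_of_lambda (Some (2^-1 +i* y)) = Some (edge_j y)%:C.
Proof.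
have y0 : 1 / 4 + y ^+ 2 != 0 by rewrite gt_eqF// ltr_pwDl ?sqr_ge0// divr_gt0.
have v0 : y * (2 * 2^-1 - 1) = 0 by field.
have u1 : 2^-1 ^+ 2 - y ^+ 2 - 2^-1 + 1 - 1 = - (1 / 4 + y ^+ 2) by field.
rewrite /= j_num j_den v0 u1 /P1_of !(mulr0, mul0r, expr0n, subr0, oppr0) /= ifF; last first.
  apply/negbTE; rewrite eq_complex /= negb_and sqrrN mulf_neq0 ?expf_neq0 ?pnatr_eq0 //.
congr Some; rewrite complex_div; apply/eqP; rewrite eq_complex /= /edge_j.
rewrite !(mulr0, mul0r, expr0n, subr0, addr0, oppr0) /= eqxx andbT; apply/eqP; field.
by rewrite gt_eqF// ltr_pwDl// mulr_ge0 ?sqr_ge0.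
Qed.

(** With t = y ^ 2, the difference of the denominator and the numerator is
    4 t (t + 9/4) ^ 2: this is the double ramification of j over 1. *)
Lemma edge_j_01 y : y ^+ 2 <= 3 / 4 -> 0 <= edge_j y <= 1.
Proof.
move=> y34; have y0 := sqr_ge0 y; rewrite /edge_j; move: (y ^+ 2) y34 y0 => t t34 t0.
have d0 : 0 < 27 * (1 / 4 + t) ^+ 2 by rewrite mulr_gt0// exprn_gt0//; lra.
rewrite ler_pdivlMr// mul0r ler_pdivrMr// mul1r; apply/andP; split.
  by rewrite mulr_ge0// exprn_ge0//; lra.
rewrite -subr_ge0 (_ : _ - _ = 4 * t * (t + 9 / 4) ^+ 2); last by field.
by rewrite mulr_ge0 ?sqr_ge0// mulr_ge0.
Qed.

Lemma edge_j_lt0 y : 3 / 4 < y ^+ 2 -> edge_j y < 0.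
Proof.
move=> y34; rewrite /edge_j; move: (y ^+ 2) y34 => t t34.
have d0 : 0 < 27 * (1 / 4 + t) ^+ 2 by rewrite mulr_gt0// exprn_gt0//; lra.
rewrite ltr_pdivrMr// mul0r pmulr_rlt0// exprn_odd_lt0//; lra.
Qed.

Lemma edge_j_decr y y' : 0 <= y -> y < y' -> y' ^+ 2 <= 3 / 4 -> edge_j y' < edge_j y.
Proof.
move=> y0 yy' hy'; have : y ^+ 2 < y' ^+ 2.
  by rewrite ltr_pXn2r// nnegrE// (le_trans y0)// ltW.
have := sqr_ge0 y; rewrite /edge_j; move: (y ^+ 2) (y' ^+ 2) hy' => t t' t'34 t0 tt'.
rewrite ltr_pdivrMr; last by rewrite mulr_gt0// exprn_gt0//; lra.
rewrite mulrAC ltr_pdivlMr; last by rewrite mulr_gt0// exprn_gt0//; lra.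
apply: (@lt_le_trans _ _ (4 * (3 / 4 - t) ^+ 3 * (27 * (1 / 4 + t) ^+ 2))).
  rewrite ltr_pM2r; last by rewrite mulr_gt0// exprn_gt0//; lra.
  by rewrite ltr_pM2l// ltr_pXn2r ?nnegrE//; lra.
rewrite ler_wpM2l//; first by rewrite mulr_ge0// exprn_ge0//; lra.
by rewrite ler_pM2l// ler_pXn2r ?nnegrE//; lra.
Qed.

Lemma edge_j_inj y y' : 0 <= y -> 0 <= y' -> y ^+ 2 <= 3 / 4 -> y' ^+ 2 <= 3 / 4 ->
  edge_j y = edge_j y' -> y = y'.
Proof.
move=> y0 y'0 hy hy' e; case: (ltgtP y y') => // l.
  by have := edge_j_decr y0 l hy'; rewrite e ltxx.
by have := edge_j_decr y'0 l hy; rewrite e ltxx.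
Qed.

End JInvariant.

(** * The three regions in the lambda-sphere *)

Section Regions.
Variable R : realType.
Local Open Scope ring_scope.
Local Open Scope complex_scope.
Implicit Types (z w : R[i]) (x y s : R) (p : P1 R).

(** The face of the theta graph that contains 0; the two other faces, around 1
    and infinity, are obtained from it by the anharmonic group. *)
Definition region0 : set (P1 R) :=
  fun p => if p is Some z then sqmod z < 1 /\ 2 * complex.Re z < 1 else False.
Definition region1 : set (P1 R) := affine (-1) 1 @^-1` region0.
Definition regionoo : set (P1 R) := @inversion R @^-1` region0.

(** The conditions are |z - 1| < 1 and Re z > 1/2. *)
Lemma region1E x y :
  region1 (Some (x +i* y)) <-> x ^+ 2 + y ^+ 2 < 2 * x /\ 1 < 2 * x.
Proof.
rewrite /region1 /preimage /region0 /= /sqmod /=.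
rewrite !(mulN1r, mulr0, mul0r, mulNr, subr0, addr0, mul1r, oppr0, sqrrN).
by split => -[h1 h2]; split; nra.
Qed.

Lemma inversionE x y : x +i* y != 0 -> inversion (Some (x +i* y)) =
  Some ((x / (x ^+ 2 + y ^+ 2)) +i* (- (y / (x ^+ 2 + y ^+ 2)))).
Proof.
by move=> z0; rewrite /= /P1_of (negbTE z0) div1r; congr Some.
Qed.

(** The conditions are |z| > 1 and |z - 1| > 1. *)
Lemma regionooE x y :
  regionoo (Some (x +i* y)) <-> 1 < x ^+ 2 + y ^+ 2 /\ 2 * x < x ^+ 2 + y ^+ 2.
Proof.
have [[-> ->]|z0] := eqVneq (x +i* y) 0.
  rewrite /regionoo /preimage /mkset /= /P1_of eqxx expr0n /= addr0.
  by split => // -[]; rewrite ltr10.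
rewrite /regionoo /preimage /mkset inversionE // /region0 -[_ +i* - _]/((x +i* y)^-1) sqmodV /=.
have A0 : 0 < x ^+ 2 + y ^+ 2 by have := sqmod_gt0 (x +i* y); rewrite z0 => h; exact: h.
rewrite -[sqmod _]/(x ^+ 2 + y ^+ 2) invf_lt1// mulrA ltr_pdivrMr// mul1r.
by [].
Qed.

Lemma regionoo_None : regionoo None.
Proof. by rewrite /regionoo /preimage /= /sqmod /= expr0n mulr0 addr0. Qed.

Lemma region0_open : open region0.
Proof.
rewrite openE => -[z [z1 z2]|//].
have n1 : \forall w \near (z : R[i]^o), sqmod w < 1.
  by apply: (@continuous_sqmod R z [set x | x < 1]); exact: lt_nbhsl.
have n2 : \forall w \near (z : R[i]^o), complex.Re w < 2^-1.
  apply: (@continuous_Re R z [set x | x < 2^-1]); apply: lt_nbhsl; lra.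
apply: filterS2 n1 n2 => w w1 w2; split => //; lra.
Qed.

(** The face is star-shaped with respect to 0. *)
Lemma region0_connected : connected region0.
Proof.
pose ray p : set (P1 R) := if p is Some z then
  (fun t : R => Some (t%:C * z) : P1 R) @` `[0, 1] else set0.
rewrite (_ : region0 = \bigcup_(p in region0) ray p).
  apply: bigcup_connected.
    exists (Some 0) => -[z|//] _ /=; exists 0; rewrite ?mul0r//= in_itv /=.
    by rewrite lexx ler01.
  move=> [z|//] _; apply: connected_continuous_connected; last first.
    apply: continuous_subspaceT => t.
    apply: (@continuous_comp _ R[i]^o (P1 R) (fun t : R => t%:C * z) Some).
      apply: (@cvgM R[i] _ (nbhs t) _ (fun t : R => t%:C : R[i]^o) (fun=> z)).
        exact: continuous_real_complex.
      exact: (@cvg_cst R[i]^o).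
    exact: (@one_point_compactification_some_continuous R[i]^o).
  by apply: segment_connected.
apply/seteqP; split => [[z|//] z0|p [[z|//] [z1 z2]] [t]].
  by exists (Some z) => //=; exists 1; rewrite ?mul1r//= in_itv /= ler01 lexx.
rewrite /= in_itv /= => /andP[t0 t1] <-; move: z1 z2.
rewrite /= sqmodM /sqmod /=; case: z => x y /=.
rewrite expr0n /= mul0r addr0 subr0.
have := sqr_ge0 x; have := sqr_ge0 y.
move=> y0 x0 z1 z2; split; last first.
  have [->|tn0] := eqVneq t 0; first by rewrite mul0r mulr0 ltr01.
  have tx : 0 < t * (1 - 2 * x) by rewrite mulr_gt0 ?lt0r ?tn0//; lra.
  lra.
apply: le_lt_trans z1; rewrite ler_piMl ?addr_ge0// expr_le1 //.
Qed.

End Regions.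

Local Arguments j_of_lambda : simpl never.

Section Complement.
Variable R : realType.
Local Open Scope ring_scope.
Local Open Scope complex_scope.
Implicit Types (z w : R[i]) (x y s : R) (p : P1 R).

Definition unit_segment : set (P1 R) := [set Some s%:C | s in `[0, 1]%classic].

Lemma edge_in_dessin p y : p = Some (2^-1 +i* y) -> y ^+ 2 <= 3 / 4 ->
  unit_segment (j_of_lambda p).
Proof.
move=> -> /edge_j_01 y01; rewrite j_edge; exists (edge_j y) => //=.
Qed.

(** The circle |z - 1| = 1 passes through 0, so the inversion straightens it
    into the line Re z = 1/2, where j is known. *)
Lemma circle_to_line x y : 0 < x -> x ^+ 2 + y ^+ 2 = 2 * x ->
  exists2 y', inversion (Some (x +i* y)) = Some (2^-1 +i* y') &
              y' ^+ 2 = (2 * x)^-1 - 4^-1.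
Proof.
move=> x0 A; rewrite inversionE ?A; last by rewrite eq_complex /= negb_and gt_eqF.
exists (- (y / (2 * x))).
  by congr (Some (_ +i* _)); field; rewrite gt_eqF.
rewrite sqrrN expr_div_n (_ : y ^+ 2 = 2 * x - x ^+ 2); last by rewrite -A; ring.
by field; rewrite gt_eqF.
Qed.

(** A point outside the three faces lies on one of the arcs of the theta graph;
    the symmetries carry the arc to the segment of the line Re z = 1/2. *)
Lemma outside_regions p : ~ region0 p -> ~ region1 p -> ~ regionoo p ->
  unit_segment (j_of_lambda p).
Proof.
case: p => [[x y]|]; last by have := @regionoo_None R.
rewrite region1E regionooE /region0 /= /sqmod /= => n0 n1 noo.
have inv1 x' y' : 1 / 2 < x' -> x' ^+ 2 + y' ^+ 2 = 2 * x' ->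
    unit_segment (j_of_lambda (Some (x' +i* y'))).
  move=> hx A; have x'0 : 0 < x' by lra.
  have [y'' e1 e2] := circle_to_line x'0 A.
  rewrite -j_inversion; apply: edge_in_dessin e1 _; rewrite e2.
  have : (2 * x')^-1 <= 1 by rewrite invf_le1; lra.
  lra.
have [x12|x12|x12] := ltgtP x (1 / 2).
- have A : x ^+ 2 + y ^+ 2 = 1.
    have a1 : 1 <= x ^+ 2 + y ^+ 2.
      by rewrite leNgt; apply/negP => h; apply: n0; split => //; lra.
    by apply/eqP; rewrite eq_le a1 andbT leNgt; apply/negP => h; apply: noo; split => //; lra.
  rewrite -j_one_sub /= (_ : -1 * (x +i* y) + 1 = (1 - x) +i* - y).
    by apply: inv1; [lra|rewrite sqrrN -[y ^+ 2](addKr (x ^+ 2)) A; ring].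
  by rewrite mulN1r; apply/eqP; rewrite eq_complex /= addr0 addrC !eqxx.
- apply: inv1 => //.
  have a1 : 2 * x <= x ^+ 2 + y ^+ 2.
    by rewrite leNgt; apply/negP => h; apply: n1; split => //; lra.
  by apply/eqP; rewrite eq_le a1 andbT leNgt; apply/negP => h; apply: noo; split => //; lra.
- rewrite x12 div1r; apply: edge_in_dessin; first by [].
  rewrite leNgt; apply/negP => h; apply: noo; rewrite x12; split; lra.
Qed.

(** If j is real in the face, the factorization of Im j leaves the real line,
    where j > 1, and the circle |z - 1| = 1, where j < 0. *)
Lemma region0_not_dessin p : region0 p -> ~ unit_segment (j_of_lambda p).
Proof.
case: p => [[x y]|//]; rewrite /region0 /= /sqmod /= => -[A1 x1] [s].
rewrite /= in_itv /= => /andP[s0 s1] js.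
have [k k0] := Im_j (esym js); rewrite /= => /esym/eqP.
rewrite !mulf_eq0 gt_eqF//= => /orP[/orP[/orP[]|]|] /eqP h; last first.
- (* The inversion takes the circle |z - 1| = 1 to the line Re z = 1/2; as
     |z| < 1, the image is off the edge, where j < 0. *)
  have A : x ^+ 2 + y ^+ 2 = 2 * x by lra.
  have [x0|x0] := ltP 0 x.
    have [y' e1 e2] := circle_to_line x0 A.
    move: js; rewrite -[in RHS]/(j_of_lambda (Some (x +i* y))) -j_inversion e1 j_edge => -[sE].
    have := @edge_j_lt0 _ y'; rewrite e2 -sE => /(_ _)/wrap[]; last by lra.
    have : 1 < (2 * x)^-1 by rewrite invf_gt1; lra.
    lra.
  have [z0 _] := j_finite_neq (esym js).
  have := sqmod_gt0 (x +i* y); rewrite z0 /sqmod /= A; lra.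
- lra.
- lra.
have [z0 _] := j_finite_neq (esym js).
have x0 : x != 0 by apply: contra_neq z0 => ->; rewrite h.
move: js; rewrite h /j_of_lambda j_num j_den mul0r !(mulr0, mul0r, expr0n, subr0) /=.
rewrite /P1_of; case: ifP => // _ [sE _]; move: sE.
rewrite /= mul0r subr0 expr0n addr0; set u := x ^+ 2 - x + 1 => sE.
have x1' : x ^+ 2 < 1 by move: A1; rewrite h expr0n addr0.
have d0 : 0 < 27 * (u - 1) ^+ 2.
  rewrite mulr_gt0// exprn_even_gt0//= (_ : u - 1 = x * (x - 1)); last by rewrite /u; ring.
  by rewrite mulf_neq0// subr_eq0; apply: contraTneq x1 => ->; rewrite -leNgt; lra.
have : 4 * u ^+ 3 <= 27 * (u - 1) ^+ 2.
  rewrite -[leRHS]mul1r -ler_pdivrMr//; move: s1; rewrite sE.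
  by rewrite expr2 invfM mulVKf // gt_eqF.
(* The square of 2 x - 1 is 4 u - 3. *)
rewrite -subr_ge0 (_ : _ - _ = - ((u - 3) ^+ 2 * (2 * x - 1) ^+ 2)); last by rewrite /u; ring.
rewrite oppr_ge0; apply/negP; rewrite -ltNge mulr_gt0// exprn_even_gt0//=.
  rewrite (_ : u - 3 = (x - 2) * (x + 1)); last by rewrite /u; ring.
  by rewrite mulf_neq0//; apply/eqP; nra.
by apply/eqP; lra.
Qed.

End Complement.

(** * The regions of a curve *)

Section Components.
Context {T : topologicalType}.

(** The component cannot leave V, as V is open and closed in it. *)
Lemma component_of_partition (A V W : set T) (x : T) :
  A = V `|` W -> open V -> open W -> V `&` W = set0 -> connected V -> V x ->
  connected_component A x = V.
Proof.
move=> AE oV oW VW cV Vx; apply/seteqP; split; last first.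
  by apply: connected_component_max => //; rewrite AE; exact: subsetUl.
set K := connected_component A x.
have KA : K `<=` V `|` W by rewrite -AE; exact: connected_component_sub.
have Kx : K x by apply: connected_component_refl; rewrite AE; left.
have KVE : K `&` V = K.
  apply: (@component_connected _ A x).
  - by exists x.
  - by exists V.
  - exists (~` W); first exact: open_closedC.
    apply/seteqP; split => y [Ky h]; split => //; last by case: (KA _ Ky).
    by move=> Wy; have : (V `&` W) y by []; rewrite VW.
by rewrite -KVE => y [].
Qed.

End Components.

Section CurveRegions.
Variables (R : realType) (C : crtc R).
Hypothesis C1 : maxdeg C = 1%N.
Local Open Scope ring_scope.
Local Open Scope complex_scope.
Implicit Types (p : P1 R) (U : set (P1 R)).

Lemma j_region1 p : region1 p -> ~ unit_segment (j_of_lambda p).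
Proof. by rewrite -j_one_sub; exact: region0_not_dessin. Qed.

Lemma j_regionoo p : regionoo p -> ~ unit_segment (j_of_lambda p).
Proof. by rewrite -j_inversion; exact: region0_not_dessin. Qed.

Lemma dessinC_regions :
  ~` dessin C = lambda C @^-1` (@region0 R `|` @region1 R `|` @regionoo R).
Proof.
apply/seteqP; split => [x Dx|x].
  apply: contrapT => /= /not_orP[/not_orP[n0 n1] noo]; apply: Dx.
  exact: outside_regions.
by move=> [[/region0_not_dessin|/j_region1]|/j_regionoo].
Qed.

Lemma regions_disjoint : [/\ @region0 R `&` @region1 R = set0,
  @region0 R `&` @regionoo R = set0 & @region1 R `&` @regionoo R = set0].
Proof.
split; apply/seteqP; split => // -[[x y]|] [];
  rewrite ?(region1E, regionooE) /region0 ?/sqmod //=; do ?[case=> ? ?]; lra.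
Qed.

Lemma homeo_preimage (f : P1 R -> P1 R) U : homeo f ->
  [/\ open U -> open (f @^-1` U), connected U -> connected (f @^-1` U) &
      forall p, U p -> (f @^-1` U) !=set0].
Proof.
move=> [g [cf cg fK gK]]; split => [||p Up].
- by apply: open_comp => x _; exact: cf.
- rewrite (_ : f @^-1` U = g @` U).
    move=> cU; apply: connected_continuous_connected => //.
    exact: continuous_subspaceT.
  apply/seteqP; split => [x Ux|_ [y Uy <-]]; last by rewrite /preimage /= gK.
  by exists (f x).
- by exists (g p); rewrite /preimage /= gK.
Qed.

(** The three charts are lambda followed by an anharmonic transformation which
    carries one of the three faces to [region0]. *)
Definition chart0 := lambda C.
Definition chart1 := affine (-1) 1 \o lambda C.
Definition chartoo := @inversion R \o lambda C.

Lemma homeo_charts : [/\ homeo chart0, homeo chart1 & homeo chartoo].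
Proof.
have hC := homeo_lambda C1; split => //; apply: homeo_comp => //.
  by apply: homeo_affine; rewrite oppr_eq0 oner_eq0.
exact: homeo_inversion.
Qed.

Lemma j_charts : [/\ @j_of_lambda R \o chart0 = j_invariant C,
  @j_of_lambda R \o chart1 = j_invariant C & @j_of_lambda R \o chartoo = j_invariant C].
Proof.
split=> //; apply/funext => x; [exact: j_one_sub|exact: j_inversion].
Qed.

Let V0 := chart0 @^-1` @region0 R.
Let V1 := chart1 @^-1` @region0 R.
Let Voo := chartoo @^-1` @region0 R.

Lemma regionsE : [/\ regions C = [set V0; V1; Voo], V0 != V1, V0 != Voo & V1 != Voo].
Proof.
have r00 : @region0 R (Some 0) by rewrite /region0 /sqmod /= expr0n mulr0 addr0.
have [h0 h1 hoo] := homeo_charts.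
have oV f : homeo f -> open (f @^-1` @region0 R).
  by move=> /(@homeo_preimage f (@region0 R))[h _ _]; apply: h; exact: region0_open.
have cV f : homeo f -> connected (f @^-1` @region0 R).
  by move=> /(@homeo_preimage f (@region0 R))[_ h _]; apply: h; exact: region0_connected.
have nV f : homeo f -> (f @^-1` @region0 R) !=set0.
  by move=> /(@homeo_preimage f (@region0 R))[_ _ h]; exact: h r00.
have [d01 d0o d1o] := regions_disjoint.
have D01 : V0 `&` V1 = set0 by rewrite -(preimage_set0 (lambda C)) -d01.
have D0o : V0 `&` Voo = set0 by rewrite -(preimage_set0 (lambda C)) -d0o.
have D1o : V1 `&` Voo = set0 by rewrite -(preimage_set0 (lambda C)) -d1o.
have cover : ~` dessin C = V0 `|` V1 `|` Voo by exact: dessinC_regions.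
have neq (A B : set (P1 R)) : A !=set0 -> A `&` B = set0 -> A != B.
  by move=> [x Ax] AB0; apply/eqP => AB; move: AB0; rewrite -AB setIid => A0; rewrite A0 in Ax.
split; [|exact: neq (nV _ h0) D01|exact: neq (nV _ h0) D0o|exact: neq (nV _ h1) D1o].
have comp0 x : V0 x -> connected_component (~` dessin C) x = V0.
  apply: (@component_of_partition _ _ _ (V1 `|` Voo)); last exact: cV.
  - by rewrite cover setUA.
  - exact: oV.
  - by apply: openU; exact: oV.
  - by rewrite setIUr D01 D0o setU0.
have comp1 x : V1 x -> connected_component (~` dessin C) x = V1.
  apply: (@component_of_partition _ _ _ (V0 `|` Voo)); last exact: cV.
  - by rewrite cover setUA (setUC V0).
  - exact: oV.
  - by apply: openU; exact: oV.
  - by rewrite setIUr (setIC V1) D01 D1o setU0.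
have compoo x : Voo x -> connected_component (~` dessin C) x = Voo.
  apply: (@component_of_partition _ _ _ (V0 `|` V1)); last exact: cV.
  - by rewrite cover setUC.
  - exact: oV.
  - by apply: openU; exact: oV.
  - by rewrite setIUr !(setIC Voo) D0o D1o setU0.
apply/seteqP; split => [_ [x Dx <-]|U].
  have : (V0 `|` V1 `|` Voo) x by rewrite -cover.
  move=> -[[]|] Vx.
  - by left; left; exact: comp0.
  - by left; right; exact: comp1.
  - by right; exact: compoo.
move=> -[[]|] ->.
- have [x Vx] := nV _ h0; exists x; last exact: comp0.
  by rewrite cover; left; left.
- have [x Vx] := nV _ h1; exists x; last exact: comp1.
  by rewrite cover; left; right.
- have [x Vx] := nV _ hoo; exists x; last exact: compoo.
  by rewrite cover; right.
Qed.

End CurveRegions.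

(** * The half-edge on the line Re z = 1/2, parametrized by j *)

Section EdgeParam.
Variable R : realType.
Local Open Scope ring_scope.
Local Open Scope complex_scope.
Implicit Types (x y s t : R).

Lemma continuous_edge_j : continuous (@edge_j R).
Proof.
move=> y; have sq : (fun y : R => y ^+ 2) @ y --> y ^+ 2 by exact: exprn_continuous.
have pow (f : R -> R) (l : R) n : f @ y --> l -> (fun y => f y ^+ n) @ y --> l ^+ n.
  by move=> fl; exact: (cvg_comp _ _ fl (@exprn_continuous R n l)).
apply: cvgM.
  apply: cvgM; first exact: cvg_cst.
  by apply: pow; apply: cvgB => //; exact: cvg_cst.
apply: cvgV.
  by rewrite gt_eqF// mulr_gt0// exprn_gt0// ltr_pwDl ?sqr_ge0// divr_gt0.
apply: cvgM; first exact: cvg_cst.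
by apply: pow; apply: cvgD => //; exact: cvg_cst.
Qed.

Definition half_height : R := Num.sqrt (3 / 4).

Lemma half_height_ge0 : 0 <= half_height. Proof. exact: sqrtr_ge0. Qed.

Lemma half_heightE : half_height ^+ 2 = 3 / 4.
Proof. by rewrite sqr_sqrtr// divr_ge0. Qed.

Lemma edge_j0 : edge_j (0 : R) = 1.
Proof. by rewrite /edge_j; field. Qed.

Lemma edge_j_half_height : edge_j half_height = 0.
Proof. by rewrite /edge_j half_heightE subrr expr0n mulr0 mul0r. Qed.

Lemma half_segmentP y : (y \in `[0, half_height]) = (0 <= y) && (y ^+ 2 <= 3 / 4).
Proof.
rewrite in_itv /= -half_heightE; have [y0|//] := leP 0 y.
by rewrite ler_pXn2r// nnegrE ?half_height_ge0.
Qed.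

(** The inverse of the strictly decreasing bijection [edge_j] from
    [0, half_height] to [0, 1]. *)
Definition edge_height s : R := xget 0 [set y | y \in `[0, half_height] /\ edge_j y = s].

Lemma edge_jK : {in `[0, half_height], cancel (@edge_j R) edge_height}.
Proof.
move=> y yh; rewrite /edge_height; case: xgetP => [y' _ [y'h e]|/(_ y)[]//].
move: yh y'h; rewrite !half_segmentP => /andP[y0 yh] /andP[y'0 y'h].
exact: edge_j_inj.
Qed.

Lemma edge_heightP s : s \in `[0, 1] ->
  [/\ 0 <= edge_height s, edge_height s ^+ 2 <= 3 / 4 & edge_j (edge_height s) = s].
Proof.
move=> s01; have := @segment_continuous_ge_surjective R 0 half_height (@edge_j R).
rewrite edge_j0 edge_j_half_height => /(_ half_height_ge0 ler01).
move=> /(_ (continuous_subspaceT continuous_edge_j) s s01)[y yh ys].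
have e : edge_height s = y by rewrite -ys edge_jK.
by rewrite e; move: yh; rewrite /= half_segmentP => /andP[].
Qed.

Lemma continuous_edge_height : {within `[0, 1], continuous edge_height}.
Proof.
have := @segment_can_ge_continuous R 0 half_height (@edge_j R) edge_height half_height_ge0.
rewrite edge_j0 edge_j_half_height; apply; last exact: edge_jK.
exact/continuous_subspaceT/continuous_edge_j.
Qed.

Lemma edge_height1 : edge_height 1 = 0.
Proof. by rewrite -edge_j0 edge_jK// half_segmentP lexx expr0n /= divr_ge0. Qed.

Lemma edge_height_open s : s \in `]0, 1[ -> 0 < edge_height s /\ edge_height s ^+ 2 < 3 / 4.
Proof.
rewrite in_itv /= => /andP[s0 s1].
have [h0 h34 hs] : [/\ 0 <= edge_height s, edge_height s ^+ 2 <= 3 / 4 & edge_j (edge_height s) = s].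
  by apply: edge_heightP; rewrite in_itv /= !ltW.
split.
  by rewrite lt0r h0 andbT; apply: contraTneq s1 => h; rewrite -hs h edge_j0 ltxx.
rewrite lt_neqAle h34 andbT; apply: contraTneq s0 => h.
by rewrite -hs /edge_j h subrr expr0n mulr0 mul0r ltxx.
Qed.

End EdgeParam.

(** * Boundary passages and symmetries *)

Section Transport.
Variables (R : realType) (C C' : crtc R) (f : P1 R -> P1 R) (U U' : set (P1 R)).
Hypothesis cf : continuous f.
Hypothesis jf : forall x, j_invariant C' (f x) = j_invariant C x.
Hypothesis UU' : forall x, U x -> U' (f x).
Local Open Scope ring_scope.
Local Open Scope complex_scope.

Lemma passage_param_transport g : passage_param C g -> passage_param C' (f \o g).
Proof.
move=> [cg jg]; split => [|s s01]; last by rewrite jf jg.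
exact: within_continuous_comp.
Qed.

Lemma runs_along_transport g b : runs_along C U g b -> runs_along C' U' (f \o g) b.
Proof.
move=> [H [cH H0 HU]]; exists (f \o H); split => [|s s01|s t s01 t01].
- exact: within_continuous_comp.
- by rewrite /= H0.
- have [UH [w jw sw]] := HU _ _ s01 t01; split; first exact: UU'.
  by exists w => //; rewrite jf.
Qed.

(** Passages and the side along which they run depend on the curve only through
    its j-invariant. *)
Lemma boundary_passages_transport p : boundary_passages C U p ->
  boundary_passages C' U' (f @` p.1, p.2).
Proof.
move=> [g [pg pE rg]]; exists (f \o g); split.
- exact: passage_param_transport.
- by rewrite /= pE image_comp.
- exact: runs_along_transport.
Qed.

End Transport.

Section StandardPassages.
Variable R : realType.
Local Open Scope ring_scope.
Local Open Scope complex_scope.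
Local Notation C0 := (std_curve R).
Implicit Types (b : bool) (s t x y : R).

(** Near the segment of the line Re z = 1/2, [region0] is on the left of the
    lower half and on the right of the upper half, both being directed towards
    1/2; [side_sign] is the sign of Im z on the half with [region0] on the
    side b. *)
Definition side_sign b : R := if b then -1 else 1.

Definition edge b s : P1 R := Some (2^-1 +i* (side_sign b * edge_height s)).

Lemma side_sign_sqr b : side_sign b ^+ 2 = 1.
Proof. by case: b; rewrite /side_sign ?sqrrN expr1n. Qed.

Lemma j_edge_path b s : s \in `[0, 1] -> j_of_lambda (edge b s) = Some s%:C.
Proof.
move=> /edge_heightP[_ _ hs]; rewrite /edge j_edge.
suff -> : edge_j (side_sign b * edge_height s) = s by [].
by rewrite -{2}hs /edge_j exprMn side_sign_sqr !mul1r.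
Qed.

Lemma passage_edge b : passage_param C0 (edge b).
Proof.
split=> [|s s01]; last by rewrite j_invariant_std_curve j_edge_path.
apply/subspace_continuousP => s s01.
have hs := (@subspace_continuousP R `[0, 1] R (@edge_height R)).1 (@continuous_edge_height R) s s01.
apply: (@cvg_comp _ _ _
  (fun s => 2^-1 +i* (side_sign b * edge_height s) : R[i]^o) Some _
  (nbhs (2^-1 +i* (side_sign b * edge_height s) : R[i]^o))); last first.
  exact: (@one_point_compactification_some_continuous R[i]^o).
apply: cvg_complex; first exact: cvg_cst.
apply: (@cvgM R); last exact: hs.
exact: cvg_cst.
Qed.

(** In [region0] two of the factors of Im j are negative, which leaves the
    product of the equations of the real line and of |z - 1| = 1. *)
Lemma on_side_region0 b x y :
  on_side C0 b (Some (x +i* y)) -> region0 (Some (x +i* y)) ->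
  side_sign b * (y * (x ^+ 2 + y ^+ 2 - 2 * x)) < 0.
Proof.
move=> [w]; rewrite j_invariant_std_curve => /Im_j[k k0 ->] sw [A1 x1].
rewrite /sqmod /= in A1 x1.
set A := x ^+ 2 + y ^+ 2 in A1 sw *.
have pos : 0 < k * ((2 * x - 1) * (A - 1)).
  by rewrite mulr_gt0// nmulr_rgt0; lra.
move: sw; rewrite (_ : k * _ = k * ((2 * x - 1) * (A - 1)) * (y * (A - 2 * x))); last by ring.
case: b; rewrite /side_sign /=; first by rewrite (pmulr_rgt0 _ pos) mulN1r oppr_lt0.
by rewrite (pmulr_rlt0 _ pos) mul1r.
Qed.

Lemma region0_on_side b x y : region0 (Some (x +i* y)) ->
  side_sign b * (y * (x ^+ 2 + y ^+ 2 - 2 * x)) < 0 ->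
  on_side C0 b (Some (x +i* y)).
Proof.
move=> [A1 x1] sy; rewrite /sqmod /= in A1 x1.
have [w jw] : exists w, j_of_lambda (Some (x +i* y)) = Some w.
  by apply: j_finite; apply/eqP => -[_ ey]; move: sy; rewrite ey mul0r mulr0 ltxx.
exists w; rewrite ?j_invariant_std_curve//.
have [k k0 ->] := Im_j jw.
set A := x ^+ 2 + y ^+ 2 in A1 sy *.
have pos : 0 < k * ((2 * x - 1) * (A - 1)).
  by rewrite mulr_gt0// nmulr_rgt0; lra.
move: sy; rewrite (_ : k * _ = k * ((2 * x - 1) * (A - 1)) * (y * (A - 2 * x))); last by ring.
case: b; rewrite /side_sign /=; first by rewrite (pmulr_rgt0 _ pos) mulN1r oppr_lt0.
by rewrite (pmulr_rlt0 _ pos) mul1r.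
Qed.

(** The half-edge is pushed off by the homotheties of ratio 1 - t / 2, which
    take it into the intersection of the two disks, to the left of the line
    Re z = 1/2; the sign of Im z does not change. *)
Lemma runs_along_edge b : runs_along C0 (@region0 R) (edge b) b.
Proof.
pose r t : R := 1 - t / 2.
exists (fun p => Some ((r p.2 / 2) +i* (r p.2 * (side_sign b * edge_height p.1)))).
split.
- apply/subspace_continuousP => -[s t] [s01 t01].
  have hs := (@subspace_continuousP R `[0, 1] R (@edge_height R)).1 (@continuous_edge_height R) s s01.
  have hs' : edge_height p.1 @[p --> within (`[0, 1] `*` `[0, 1]) (nbhs (s, t))] --> edge_height s.
    apply: cvg_comp hs => A /= wA.
    rewrite /within /=.
    have : nbhs (s, t) (fst @^-1` [set x | x \in `[0, 1] -> A x]).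
      exact: (@cvg_fst _ _ (nbhs s) (nbhs t) _ _ wA).
    by apply: filterS => -[u v] /= h [u01 v01]; exact: h.
  have ht : r p.2 @[p --> within (`[0, 1] `*` `[0, 1]) (nbhs (s, t))] --> r t.
    have ht0 : r p.2 @[p --> nbhs (s, t)] --> r t.
      apply: (@cvgB R R _ (nbhs (s, t)) _ (fun=> 1) (fun p => p.2 / 2)); first exact: (@cvg_cst R).
      apply: (@cvgM R _ (nbhs (s, t)) _ snd (fun=> 2^-1)); last exact: (@cvg_cst R).
      exact: (@cvg_snd _ _ (nbhs s) (nbhs t)).
    by move=> A /ht0 h; exact: (@filterS _ (nbhs (s, t)) _ _ _ (fun p pA _ => pA) h).
  apply: (@cvg_comp _ _ _
    (fun p : R * R => (r p.2 / 2) +i* (r p.2 * (side_sign b * edge_height p.1)) : R[i]^o)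
    Some _ (nbhs ((r t / 2) +i* (r t * (side_sign b * edge_height s)) : R[i]^o))); last first.
    exact: (@one_point_compactification_some_continuous R[i]^o).
  apply: cvg_complex; first by apply: cvgM => //; exact: cvg_cst.
  by apply: cvgM => //; apply: cvgM => //; exact: cvg_cst.
- by move=> s s01; rewrite /edge /r /= mul0r subr0 !mul1r.
move=> s t s01; rewrite in_itv /= => /andP[t0 t1].
have [h0 h34] := edge_height_open s01.
have [r0 r1] : 0 < r t /\ r t < 1 by rewrite /r; split; lra.
move: (r t) r0 r1 (edge_height s) h0 h34 => {t t0 t1 s01}r r0 r1 h h0 h34 /=.
have r2 : r ^+ 2 < r by rewrite expr2 gtr_pMl.
have sb := side_sign_sqr b.
have A : (r / 2) ^+ 2 + (r * (side_sign b * h)) ^+ 2 = r ^+ 2 * (1 / 4 + h ^+ 2).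
  by rewrite !exprMn sb exprVn; field.
have Ar : r ^+ 2 * (1 / 4 + h ^+ 2) < r.
  by apply: le_lt_trans r2; rewrite ler_piMr ?sqr_ge0//; lra.
have r0U : region0 (Some ((r / 2) +i* (r * (side_sign b * h)))).
  split; rewrite /sqmod /= ?A; lra.
split => //; apply: region0_on_side => //; rewrite A.
rewrite (_ : _ * _ = side_sign b ^+ 2 * (r * h * (r ^+ 2 * (1 / 4 + h ^+ 2) - r))); last by field.
rewrite sb mul1r pmulr_rlt0; [lra|exact: mulr_gt0].
Qed.

Definition ImP (p : P1 R) : R := if p is Some z then complex.Im z else 0.

(** The parameters for which a pushed-off passage is required to lie in the
    region. *)
Definition open_strip : set (R * R) := `]0, 1[ `*` `]0, 1].

Lemma open_strip_connected : connected open_strip.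
Proof.
pose comb s : set (R * R) := (fun t => (s, t)) @` `]0, 1] `|` (fun s' => (s', 1)) @` `]0, 1[.
have h1 : (1 : R) \in `]0, 1] by rewrite in_itv /= ltr01 lexx.
have h2 : (2^-1 : R) \in `]0, 1[ by rewrite in_itv /=; apply/andP; split; lra.
have itv_conn (i : interval R) : connected [set` i].
  exact: ((connected_intervalP _).2 (@interval_is_interval R _)).
rewrite (_ : open_strip = \bigcup_(s in `]0, 1[) comb s).
  apply: bigcup_connected.
    by exists (2^-1, 1) => s s01; right; exists (2^-1).
  move=> s s01; apply: connectedU.
  - by exists (s, 1); split; [exists 1|exists s].
  - apply: connected_continuous_connected; first exact: itv_conn.
    apply: continuous_subspaceT => t.
    exact: (@cvg_pair _ _ _ (nbhs t) (nbhs s) (nbhs t) _ _ _ (fun=> s) id (cvg_cst s) (@cvg_id _ _)).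
  - apply: connected_continuous_connected; first exact: itv_conn.
    apply: continuous_subspaceT => t.
    exact: (@cvg_pair _ _ _ (nbhs t) (nbhs t) (nbhs (1 : R)) _ _ _ id (fun=> 1) (@cvg_id _ _) (cvg_cst (1 : R))).
apply/seteqP; split => [[s t] [s01 t01]|p [s s01 [[t t01 <-]|[t t01 <-]]]].
- by exists s => //; left; exists t.
- by split.
- by split.
Qed.

End StandardPassages.

(** * Uniqueness of the passages along region0 *)

Section Uniqueness.
Variable R : realType.
Local Open Scope ring_scope.
Local Open Scope complex_scope.
Local Notation C0 := (std_curve R).
Implicit Types (b : bool) (s t x y : R).

Section Push.
Variables (g : R -> P1 R) (H : R * R -> P1 R).
Hypothesis cH : {within `[0, 1] `*` `[0, 1], continuous H}.
Hypothesis H0 : forall s, s \in `[0, 1] -> H (s, 0) = g s.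

(** Every point of the passage, endpoints included, is a limit of points of the
    pushed-off part. *)
Lemma push_approx s (V : set (P1 R)) : s \in `[0, 1] -> nbhs (g s) V ->
  exists2 q, open_strip q & V (H q).
Proof.
move=> s01; rewrite -H0// => HV.
have Hc := (@subspace_continuousP (R * R)%type (`[0, 1] `*` `[0, 1]) _ H).1 cH (s, 0).
have {Hc} : nbhs (s, 0) [set q | (`[0, 1] `*` `[0, 1])%classic q -> V (H q)].
  by apply: Hc => //; split => //=; rewrite in_itv /= lexx ler01.
(* The path runs to the center of the strip, since for s = 0 or s = 1 the
   vertical segment over s is not in the strip. *)
pose path t : R * R := (s + t * (2^-1 - s), t).
have cpath : path t @[t --> 0^'+] --> (s, (0 : R)).
  apply: cvg_at_right_filter.
  have c1 : s + t * (2^-1 - s) @[t --> nbhs (0 : R)] --> s.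
    rewrite -[X in _ --> X]addr0 -[X in _ --> _ + X](mul0r (2^-1 - s)).
    apply: (@cvgD R R _ (nbhs (0 : R)) _ (fun=> s) (fun t => t * (2^-1 - s))).
      exact: (@cvg_cst R).
    by apply: (@cvgM R _ (nbhs (0 : R)) _ id (fun=> 2^-1 - s)); [exact: cvg_id|exact: (@cvg_cst R)].
  exact: (@cvg_pair _ _ _ (nbhs (0 : R)) (nbhs s) (nbhs (0 : R)) _ _ _ _ id c1 (@cvg_id _ _)).
move=> /cpath near1.
have near2 : \forall t \near 0^'+, (t : R) \in `]0, 1[.
  apply: filterS2 (nbhs_right_gt (0 : R)) (nbhs_right_lt (@ltr01 R)) => t t0 t1.
  by rewrite in_itv /= t0 t1.
have [t [/= Vt t01]] := @filter_ex _ (0 : R)^'+ _ _ (@filterI _ (0 : R)^'+ _ _ _ near1 near2).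
move: s01 t01; rewrite !in_itv /= => /andP[s0 s1] /andP[t0 t1].
have a0 : 0 < s + t * (2^-1 - s).
  rewrite (_ : _ + _ = s * (1 - t) + t / 2); last by ring.
  by rewrite ltr_wpDl ?mulr_ge0 ?divr_gt0//; lra.
have a1 : s + t * (2^-1 - s) < 1.
  rewrite -subr_gt0 (_ : _ - _ = (1 - s) * (1 - t) + t / 2); last by field.
  by rewrite ltr_wpDl ?mulr_ge0 ?divr_gt0//; lra.
exists (path t).
  by split; rewrite /= in_itv /= ?a0 ?a1 ?t0 ?ltW.
by apply: Vt; split; rewrite /= in_itv /= !ltW.
Qed.

Lemma push_le s (phi : R[i]^o -> R) z (c : R) : s \in `[0, 1] -> continuous phi ->
  g s = Some z -> (forall q w, open_strip q -> H q = Some w -> phi w <= c) -> phi z <= c.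
Proof.
move=> s01 cphi gs Hle; rewrite leNgt; apply/negP => zc.
have nz : nbhs (z : R[i]^o) [set w | c < phi w].
  by apply: (cphi z [set u | c < u]); exact: lt_nbhsr.
have : nbhs (g s) (Some @` [set w : R[i]^o | c < phi w]).
  by rewrite gs; exact: one_point_compactification_some_nbhs.
move=> /(push_approx s01)[q Qq [w /= cw Hw]].
by have := Hle q w Qq (esym Hw); rewrite leNgt cw.
Qed.

Lemma ImP_continuous p : p != None -> {for p, continuous (@ImP R)}.
Proof.
by case: p => // z _ A HA; exact: (@continuous_Im R z A HA).
Qed.

(** Im z does not vanish on the connected image of the strip, as it divides
    Im j. *)
Lemma push_half_plane b :
  (forall q, open_strip q -> region0 (H q) /\ on_side C0 b (H q)) ->
  (forall q, open_strip q -> 0 < side_sign R b * ImP (H q)) \/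
  (forall q, open_strip q -> side_sign R b * ImP (H q) < 0).
Proof.
move=> HU.
have Im0 q : open_strip q -> side_sign R b * ImP (H q) != 0.
  move=> /HU; case: (H q) => [[x y]|[]//] [r0 sb].
  apply/eqP => /= e; have := on_side_region0 sb r0.
  by rewrite mulrA e mul0r ltxx.
pose f q := side_sign R b * ImP (H q).
have /connected_intervalP I : connected (f @` @open_strip R).
  apply: connected_continuous_connected; first exact: open_strip_connected.
  apply/subspace_continuousP => q Qq.
  have Hq : H @ within (@open_strip R) (nbhs q) --> H q.
    have sub : @open_strip R `<=` `[0, 1] `*` `[0, 1].
      by move=> [s t] [] /=; rewrite !in_itv /= => /andP[/ltW-> /ltW->] /andP[/ltW->].
    have cH' := continuous_subspaceW sub cH.
    exact: ((@subspace_continuousP (R * R)%type (@open_strip R) _ H).1 cH' q Qq).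
  apply: (@cvgM R _ _ _ (fun=> side_sign R b) (@ImP R \o H)); first exact: (@cvg_cst R).
  apply: cvg_comp Hq _; apply: ImP_continuous.
  by have [] := HU _ Qq; case: (H q).
have h q : open_strip q -> (f @` @open_strip R) (f q) by exists q.
have [[q0 Q0 f0]|N] := pselect (exists2 q, open_strip q & f q < 0).
  right => q Qq; rewrite ltNge; apply/negP => fq.
  have [q' Q' f'] : (f @` @open_strip R) 0.
    by apply: (I (f q0) (f q)); [exact: h|exact: h|rewrite (ltW f0)].
  by have := Im0 _ Q'; rewrite -/(f q') f' eqxx.
left => q Qq; rewrite lt0r Im0//= leNgt; apply/negP => fq.
by apply: N; exists q.
Qed.

(** The conditions Re z < 1/2, |z| < 1, |z - 1| < 1 and the sign of Im z hold
    along the push-off; in the limit they hold as weak inequalities on the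
    passage.  A passage lies in the dessin, hence not in [region0], and this
    leaves the half-edge on the line Re z = 1/2.  There j determines the point. *)
Lemma push_edge b s : passage_param C0 g ->
  (forall q, open_strip q -> region0 (H q) /\ on_side C0 b (H q)) ->
  (forall q, open_strip q -> 0 < side_sign R b * ImP (H q)) ->
  s \in `[0, 1] -> g s = edge b s.
Proof.
move=> [_ jg] HU HIm s01; have := jg s s01; rewrite j_invariant_std_curve.
case gs : (g s) => [[x y]|//] js.
have HP q u v : open_strip q -> H q = Some (u +i* v) ->
    [/\ u ^+ 2 + v ^+ 2 < 1, 2 * u < 1, u ^+ 2 + v ^+ 2 - 2 * u < 0 &
        0 < side_sign R b * v].
  move=> Qq Hq; have [r0 sb] := HU _ Qq; have := HIm _ Qq.
  rewrite Hq /= => sv; rewrite Hq in r0 sb.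
  have := on_side_region0 sb r0; rewrite mulrA pmulr_rlt0// => Av.
  by case: r0; rewrite /sqmod.
have x12 : x <= 2^-1.
  apply: (push_le s01 (@continuous_Re R) gs) => q [u v] Qq Hq.
  by have [_ ? _ _] := HP _ _ _ Qq Hq; rewrite /=; lra.
have A1 : x ^+ 2 + y ^+ 2 <= 1.
  apply: (push_le s01 (@continuous_sqmod R) gs) => q [u v] Qq Hq.
  by have [? _ _ _] := HP _ _ _ Qq Hq; rewrite ltW.
have A2x : sqmod (x +i* y) - 2 * complex.Re (x +i* y) <= 0.
  apply: (push_le (phi := fun w => sqmod w - 2 * complex.Re w) s01 _ gs) => [w|q [u v] Qq Hq].
    apply: (@cvgB R R _ (nbhs (w : R[i]^o)) _ (@sqmod R) (fun w => 2 * complex.Re w)).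
      exact: continuous_sqmod.
    apply: (@cvgM R _ (nbhs (w : R[i]^o)) _ (fun=> 2) (@complex.Re R)); first exact: (@cvg_cst R).
    exact: continuous_Re.
  by have [_ _ ? _] := HP _ _ _ Qq Hq; rewrite /sqmod /= ltW.
have sy : - side_sign R b * complex.Im (x +i* y) <= 0.
  apply: (push_le (phi := fun w => - side_sign R b * complex.Im w) s01 _ gs) => [w|q [u v] Qq Hq].
    apply: (@cvgM R _ (nbhs (w : R[i]^o)) _ (fun=> - side_sign R b) (@complex.Im R)).
      exact: (@cvg_cst R).
    exact: continuous_Im.
  by have [_ _ _ ?] := HP _ _ _ Qq Hq; rewrite mulNr oppr_le0 ltW.
rewrite /sqmod /= in A2x; rewrite mulNr oppr_le0 /= in sy.
have n0 : ~ region0 (Some (x +i* y)).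
  move=> /region0_not_dessin; apply; rewrite js; exists s => //.
have xE : x = 2^-1.
  apply/eqP; rewrite eq_le x12 /= leNgt; apply/negP => hx; apply: n0.
  by split; rewrite /sqmod /=; lra.
have sb := side_sign_sqr R b.
have yE : y = side_sign R b * (side_sign R b * y) by rewrite mulrA -expr2 sb mul1r.
rewrite /edge xE; congr (Some (_ +i* _)); rewrite {1}yE; congr (_ * _).
have <- : edge_j (side_sign R b * y) = s.
  move: js; rewrite xE j_edge => -[<-].
  by rewrite /edge_j exprMn sb !mul1r.
rewrite edge_jK// half_segmentP exprMn sb mul1r.
by move: A1 sy; rewrite xE => ? ?; apply/andP; split; lra.
Qed.

End Push.

End Uniqueness.

(** * Counting the boundary passages *)

Section CountingPassages.
Variable R : realType.
Local Open Scope ring_scope.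
Local Open Scope complex_scope.
Local Notation C0 := (std_curve R).
Local Notation I01 := (`[0, 1]%classic : set R).
Implicit Types (b : bool) (s t x y : R).

(** The anharmonic transformation z |-> z / (z - 1): it fixes 0, exchanges 1
    and infinity, and exchanges the two edges around [region0]. *)
Definition swap : P1 R -> P1 R := @inversion R \o (affine (-1) 1 \o @inversion R).

Lemma homeo_swap : homeo swap.
Proof.
have hi := homeo_inversion R; apply: (homeo_comp hi); apply: homeo_comp hi.
by apply: homeo_affine; rewrite oppr_eq0 oner_eq0.
Qed.

Lemma swapK : involutive swap.
Proof.
have aK : involutive (affine (-1) (1 : R[i])).
  by case=> [z|//] /=; congr Some; ring.
by move=> p; rewrite /swap /= inversionK aK inversionK.
Qed.

Lemma continuous_swap : continuous swap.
Proof. by have [g []] := homeo_swap. Qed.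

Lemma j_swap p : j_of_lambda (swap p) = j_of_lambda p.
Proof. by rewrite /swap /= j_inversion j_one_sub j_inversion. Qed.

Lemma swapE (z : R[i]) : z != 1 -> swap (Some z) = Some (z / (z - 1)).
Proof.
move=> z1; have z1' : z - 1 != 0 by rewrite subr_eq0.
rewrite /swap /= /P1_of; have [->|z0] := eqVneq z 0; first by rewrite /= mul0r.
have e : -1 * (1 / z) + 1 = (z - 1) / z by field.
rewrite /= e /P1_of mulf_eq0 invr_eq0 (negbTE z0) (negbTE z1') /=.
by congr Some; field; rewrite z0 z1'.
Qed.

Lemma swap_coord x y (B := (x - 1) ^+ 2 + y ^+ 2) : x +i* y != 1 -> 0 < B /\
  swap (Some (x +i* y)) = Some (((x ^+ 2 + y ^+ 2 - x) / B) +i* (- y / B)).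
Proof.
move=> z1; split.
  have := sqmod_gt0 (x +i* y - 1); rewrite subr_eq0 z1 /B /sqmod /=.
  by rewrite subr0 => h; exact: h.
rewrite swapE// (_ : x +i* y - 1 = (x - 1) +i* y); last by apply/eqP; rewrite eq_complex /= subr0 !eqxx.
by rewrite complex_div; congr (Some (_ / _ +i* (_ / _))); ring.
Qed.

Lemma region0_swap p : region0 p -> region0 (swap p).
Proof.
case: p => [[x y]|//] [A1 x1]; rewrite /sqmod /= in A1 x1.
have z1 : x +i* y != 1 by apply/eqP => -[ex _]; move: x1; rewrite ex; lra.
have [B0 ->] := swap_coord z1; set B := _ + _ in B0 *.
have BE : B = x ^+ 2 + y ^+ 2 - 2 * x + 1 by rewrite /B; ring.
have AB : ((x ^+ 2 + y ^+ 2 - x) / B) ^+ 2 + (- y / B) ^+ 2 = (x ^+ 2 + y ^+ 2) / B.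
  by rewrite (_ : x ^+ 2 + y ^+ 2 - x = (B + x ^+ 2 + y ^+ 2 - 1) / 2);
    [rewrite {2}/B /B; field; rewrite -/B gt_eqF|rewrite BE; field].
split; rewrite /sqmod /= ?AB ?mulrA ltr_pdivrMr// mul1r BE; lra.
Qed.

(** [swap] turns a push-off in the lower half-plane into one in the upper
    half-plane, and so reduces the passages along the arc to those along the
    segment. *)
Lemma ImP_swap p : region0 p -> exists2 k : R, 0 < k & ImP (swap p) = - k * ImP p.
Proof.
case: p => [[x y]|//] [A1 x1]; rewrite /sqmod /= in A1 x1.
have z1 : x +i* y != 1 by apply/eqP => -[ex _]; move: x1; rewrite ex; lra.
have [B0 ->] := swap_coord z1; set B := _ + _ in B0 *.
by exists B^-1; rewrite ?invr_gt0//= mulNr mulrC mulNr.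
Qed.

Definition edge_set b : set (P1 R) := edge b @` I01.

Lemma edge_set_passage b : boundary_passages C0 (@region0 R) (edge_set b, b).
Proof. by exists (edge b); split; [exact: passage_edge| |exact: runs_along_edge]. Qed.

Lemma swap_passage p : boundary_passages C0 (@region0 R) p ->
  boundary_passages C0 (@region0 R) (swap @` p.1, p.2).
Proof.
apply: boundary_passages_transport; first exact: continuous_swap.
  by move=> p'; rewrite !j_invariant_std_curve j_swap.
exact: region0_swap.
Qed.

(** According to the sign of Im z on the push-off, the passage or its image by
    [swap] is the half of the segment [edge p.2]. *)
Lemma boundary_passages_region0 (p : set (P1 R) * bool) :
  boundary_passages C0 (@region0 R) p ->
  p = (edge_set p.2, p.2) \/ p = (swap @` edge_set p.2, p.2).
Proof.
case: p => E b [g [/= pg -> [H [cH H0 HU]]]].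
have HU' q : open_strip q -> region0 (H q) /\ on_side C0 b (H q).
  by case: q => s t [/= s01 t01]; exact: HU.
have jsw p : j_invariant C0 (swap p) = j_invariant C0 p.
  by rewrite !j_invariant_std_curve j_swap.
have imE (g' : R -> P1 R) : (forall s, s \in `[0, 1] -> g' s = edge b s) ->
    g' @` I01 = edge_set b.
  by move=> ge; apply: eq_imagel => s /= s01; exact: ge.
have [pos|neg] := push_half_plane cH HU'; [left|right]; congr (_, _).
  by apply: imE => s s01; exact: (push_edge cH H0 pg HU' pos).
rewrite -(imE (swap \o g)).
  by rewrite image_comp; apply: eq_imagel => s _ /=; rewrite swapK.
move=> s s01.
apply: (@push_edge _ (swap \o g) (swap \o H)) => //.
- exact: within_continuous_comp cH continuous_swap.
- by move=> u u01 /=; rewrite H0.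
- exact: passage_param_transport continuous_swap jsw _ pg.
- move=> q /HU'[r0 [w jw sw]]; split; first exact: region0_swap.
  by exists w => //; rewrite jsw.
- move=> q Qq; have [r0 _] := HU' q Qq; have [k k0 /= ->] := ImP_swap r0.
  by rewrite mulNr mulrN oppr_gt0 mulrCA pmulr_rlt0//; exact: neg.
Qed.

End CountingPassages.

Section Gons.
Variable R : realType.
Local Open Scope ring_scope.
Local Open Scope complex_scope.
Local Notation C0 := (std_curve R).

(** The middle 1/2 of the segment is taken to -1, off the line Re z = 1/2. *)
Lemma edge_set_neq_swap b : @edge_set R b <> @swap R @` edge_set b.
Proof.
move=> e; have p1 : edge_set b (edge b (1 : R)).
  by exists 1 => //=; rewrite in_itv /= ler01 lexx.
have : (@swap R @` edge_set b) (swap (edge b 1)) by exists (edge b 1).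
rewrite -e => -[s _]; rewrite /edge edge_height1 mulr0.
have z1 : (2^-1 : R) +i* 0 != 1 by apply/eqP => -[]; lra.
have [_ ->] := swap_coord z1; rewrite !expr0n /= !addr0 => -[+ _].
rewrite (_ : _ / _ = -1 :> R); last by field.
lra.
Qed.

(** A chart is a homeomorphism compatible with j, so it carries the passages
    around the preimage of [region0] bijectively to those around [region0]. *)
Lemma card_boundary_passages (C : crtc R) (f : P1 R -> P1 R) :
  homeo f -> @j_of_lambda R \o f = j_invariant C ->
  #|` fset_set (boundary_passages C (f @^-1` @region0 R))| = 4%N.
Proof.
move=> [g [cf cg fK gK]] jf.
have jf' x : j_invariant C0 (f x) = j_invariant C x.
  by rewrite j_invariant_std_curve -jf.
have jg x : j_invariant C (g x) = j_invariant C0 x by rewrite -jf' gK.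
pose F (p : set (P1 R) * bool) := (g @` p.1, p.2).
have gI (A B : set (P1 R)) : g @` A = g @` B -> A = B.
  move=> /(congr1 (fun A => f @` A)); rewrite !image_comp.
  have -> : f \o g = id by apply/funext => x /=; rewrite gK.
  by rewrite !image_id.
pose E (b : bool) : set (P1 R) := @edge_set R b.
pose S (b : bool) : set (P1 R) := @swap R @` edge_set b.
pose L := [fset F (E true, true); F (S true, true); F (E false, false); F (S false, false)]%fset.
have -> : boundary_passages C (f @^-1` @region0 R) = [set` L].
  apply/seteqP; split => p.
    move=> /(@boundary_passages_transport R C C0 f _ (@region0 R) cf jf').
    move=> /(_ (fun x fx => fx)) /boundary_passages_region0 fp.
    have pE : p = F (f @` p.1, p.2).
      rewrite /F /= image_comp; have -> : g \o f = id by apply/funext => x /=; rewrite fK.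
      by rewrite image_id -surjective_pairing.
    rewrite pE; case: fp => -> /=; rewrite /L !inE /E /S; by case: (p.2); rewrite eqxx ?orbT.
  have tr q : boundary_passages C0 (@region0 R) q ->
      boundary_passages C (f @^-1` @region0 R) (F q).
    by apply: boundary_passages_transport => // x; rewrite /preimage /= gK.
  rewrite /L /= !inE -!orbA => /or4P[] /eqP ->; apply: tr.
  - exact: edge_set_passage.
  - exact/(@swap_passage R (E true, true))/edge_set_passage.
  - exact: edge_set_passage.
  - exact/(@swap_passage R (E false, false))/edge_set_passage.
rewrite set_fsetK /L -!fsetUA !cardfsU1 cardfs1 !inE /F !xpair_eqE /= !andbF !orbF.
have ES b : (g @` E b == g @` S b) = false.
  by apply/negbTE/eqP => /gI; exact: edge_set_neq_swap.
by rewrite !ES.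
Qed.

End Gons.

Lemma combinatorial_type_maxdeg1 (R : realType) (C : crtc R) :
  maxdeg C = 1%N -> combinatorial_type C = [:: 2; 2; 2]%N.
Proof.
move=> C1; have [rE n01 n0o n1o] := regionsE C1.
have [h0 h1 hoo] := homeo_charts C1; have [j0 j1 joo] := j_charts C.
set A := chart0 C @^-1` _ in rE n01 n0o.
set B := chart1 C @^-1` _ in rE n01 n1o.
set D := chartoo C @^-1` _ in rE n0o n1o.
have fE : fset_set (regions C) = [fset A; B; D]%fset.
  by rewrite rE !fset_setU // !fset_set1.
have sz : size (fset_set (regions C)) = 3%N.
  rewrite fE -fsetUA !cardfsU1 cardfs1 !inE.
  by rewrite (negbTE n01) (negbTE n0o) (negbTE n1o).
rewrite /combinatorial_type.
have /all_pred1P -> : all (pred1 2%N) [seq gon C U | U <- fset_set (regions C)].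
  apply/allP => _ /mapP[U US ->]; rewrite /= /gon.
  have : U \in [fset A; B; D]%fset by rewrite -fE.
  by rewrite !inE -orbA => /or3P[] /eqP ->; rewrite card_boundary_passages.
by rewrite size_map sz.
Qed.

Theorem proposition6 (R : realType) :
  [set combinatorial_type C | C in [set C : crtc R | maxdeg C = 1%N]]
    = [set [:: 2; 2; 2]%N].
Proof.
apply/seteqP; split => [_ [C C1 <-]|_ ->]; first exact: combinatorial_type_maxdeg1.
exists (std_curve R); first exact: maxdeg_std_curve.
exact/combinatorial_type_maxdeg1/maxdeg_std_curve.
Qed.
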